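(* For every integer $n\ge1$ and every $\lambda$ with $-1<\lambda<1$, there is exactly one switch function $\sigma\in D_n$ such that $\langle p,\sigma-\lambda\rangle=0$ for every real even polynomial $p$ of degree at most $2n-2$.
   Context: For $f\in L^1[0,1]$ and $g\in L^\infty[0,1]$, $\langle f,g\rangle=\int_0^1 g(t)f(t)\,dt$. Let $\Delta^n=\{\mathbf x\in\mathbb R^n\mid 0\le x_1\le x_2\le\dots\le x_n\le 1\}$, and put $x_0=0$, $x_{n+1}=1$. For $\mathbf x\in\Delta^n$, $\Sigma_n(\mathbf x)\in L^\infty[0,1]$ is the class of the function with $\Sigma_n(\mathbf x)(t)=(-1)^m$ for $x_m\le t<x_{m+1}$ ($0\le m\le n$) and $\Sigma_n(\mathbf x)(1)=(-1)^n$. Let $D_n=\Sigma_n(\Delta^n)\subset L^\infty[0,1]$ (elements of $L^\infty$ are identified when equal almost everywhere). *)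

(* Defs.v *)
From HB Require Import structures.
From mathcomp Require Import all_boot all_order all_algebra.
From mathcomp Require Import all_classical all_reals all_analysis.
From mathcomp Require Import measurable_realfun ess_sup_inf.

Set Implicit Arguments.
Unset Strict Implicit.
Unset Printing Implicit Defensive.

Import Order.TTheory GRing.Theory Num.Theory.
Import numFieldNormedType.Exports.

Local Open Scope classical_set_scope.
Local Open Scope ring_scope.

Definition leb01 (R : realType) : {measure set (measurableTypeR R) -> \bar R} :=
  mrestr (@lebesgue_measure R) (measurable_itv `[0, 1]).

Definition Linf (R : realType) := LspaceType (leb01 R) (leey (1 : \bar R)%E).

Lemma Linf_eqP (R : realType) (s t : Linf R) :
  s = t <-> s = t %[ae leb01 R].
Proof.
split=> [->|]; first exact: ae_eq_refl.
case: s t => [s [[hs]]] [t [[ht]]] /= st.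
have e : s = t.
  rewrite -(reprK s) -(reprK t); apply/eqP; rewrite eqmodE.
  exact/asboolP.
by subst t; rewrite (bool_irrelevance hs ht).
Qed.

Section SwitchFunctions.
Context {R : realType} {n : nat}.
Implicit Types (x : 'rV[R]_n) (t : R).

(* The coordinates of [x] are indexed from 0 by ['I_n]: [knot x m.+1] is the
   coordinate of index [m] when [m < n], and [knot x n.+1 = 1]. *)
Definition knot x (m : nat) : R :=
  if m is k.+1 then oapp (x ord0) 1 (insub k : option 'I_n) else 0.

Definition Delta : set 'rV[R]_n :=
  [set x | forall m, (m <= n)%N -> knot x m <= knot x m.+1].

(* Given by indicators so as to be measurable for every [x];
   see [switch_funE] and [switch_fun1] for the values when [x] is in [Delta]. *)
Definition switch_fun x : measurableTypeR R -> measurableTypeR R := fun t =>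
  (\sum_(m < n.+1) (-1) ^+ m * \1_(`[knot x m, knot x m.+1[ : set R) t)
  + (-1) ^+ n * \1_([set 1] : set R) t.

Lemma knot_mono x : Delta x ->
  forall i j, (i <= j)%N -> (j <= n.+1)%N -> knot x i <= knot x j.
Proof.
move=> Dx i j; elim: j => [|j ih]; first by rewrite leqn0 => /eqP ->.
rewrite leq_eqVlt => /predU1P[-> //|]; rewrite ltnS => ij jn.
by apply: (le_trans (ih ij (ltnW jn))); apply: Dx.
Qed.

Lemma knotS x : knot x n.+1 = 1.
Proof. by rewrite /knot insubN ?ltnn. Qed.

Lemma switch_funE x m t : Delta x -> (m <= n)%N ->
  knot x m <= t < knot x m.+1 -> switch_fun x t = (-1) ^+ m.
Proof.
move=> Dx mn /andP[mt tm]; rewrite /switch_fun.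
have t1 : t < 1 by rewrite (lt_le_trans tm)// -(knotS x); apply: knot_mono.
rewrite [X in _ + _ * X]indicE memNset ?mulr0 ?addr0; last first.
  by move=> /= te; rewrite te ltxx in t1.
rewrite (bigD1 (Ordinal (mn : m < n.+1)%N))//= indicE mem_set; last first.
  by rewrite /= in_itv /= mt.
rewrite mulr1 big1 ?addr0// => k km; rewrite indicE memNset ?mulr0//=.
rewrite in_itv /= => /andP[kt tk].
have : (nat_of_ord k != m) by apply: contra km => /eqP e; apply/eqP/val_inj.
rewrite neq_ltn => /orP[lt_km|lt_mk].
  have := knot_mono Dx lt_km (leqW mn).
  by rewrite leNgt (le_lt_trans mt tk).
have := knot_mono Dx lt_mk (ltnW (ltn_ord k)).
by rewrite leNgt (le_lt_trans kt tm).
Qed.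

Lemma switch_fun1 x : Delta x -> switch_fun x 1 = (-1) ^+ n.
Proof.
move=> Dx; rewrite /switch_fun indicE mem_set// mulr1 big1 ?add0r// => m _.
rewrite indicE memNset ?mulr0//= in_itv /= => /andP[_].
have k1 : knot x m.+1 <= 1 by rewrite -(knotS x); apply: knot_mono.
by rewrite ltNge k1.
Qed.

Lemma measurable_switch_fun x : measurable_fun setT (switch_fun x).
Proof.
rewrite /switch_fun; apply: measurable_funD.
  by apply: measurable_sum => m; apply: measurable_funM.
by apply: measurable_funM => //; apply: measurable_indic; exact: measurable_set1.
Qed.

HB.instance Definition _ x :=
  isMeasurableFun.Build _ _ _ _ (switch_fun x) (measurable_switch_fun x).

Lemma norm_switch_fun_le x t : `|switch_fun x t| <= n.+2%:R.
Proof.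
have b (A : set R) m : `|(-1) ^+ m * \1_A t : R| <= 1.
  rewrite normrM normrX normrN1 expr1n mul1r indicE.
  by case: (_ \in _); rewrite ?normr1 ?normr0.
rewrite -natr1 (le_trans (ler_normD _ _))// lerD//.
apply: (le_trans (ler_norm_sum _ _ _)).
apply: (@le_trans _ _ (\sum_(m < n.+1) 1)).
  by apply: ler_sum => m _; exact: b.
by rewrite sumr_const card_ord.
Qed.

Definition switch_class x :
    {mfun_ (leb01 R), measurableTypeR R >-> measurableTypeR R} :=
  \pi%qT (switch_fun x : {mfun measurableTypeR R >-> measurableTypeR R}).

Lemma switch_class_ae x : switch_class x = switch_fun x %[ae leb01 R].
Proof.
apply/asboolP.
rewrite -/(ae_eq_op _ (repr (switch_class x)) _) -eqmodE.
by apply/eqP; exact: reprK.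
Qed.

Lemma switch_class_finite x : finite_norm (leb01 R) +oo%E (switch_class x).
Proof.
rewrite /finite_norm unlock /Lnorm; case: ifPn => _ //.
rewrite (@le_lt_trans _ _ n.+2%:R%:E) ?ltry//.
apply/ess_supP.
have := switch_class_ae x; apply: filterS => t /= /(_ Logic.I) ->.
by rewrite lee_fin norm_switch_fun_le.
Qed.

HB.instance Definition _ x :=
  isFinLebesgue.Build _ _ _ _ _ (leey (1 : \bar R)%E)
    (switch_class x) (switch_class_finite x).

Definition Sigma x : Linf R := switch_class x.

End SwitchFunctions.

Definition switch_set (R : realType) (n : nat) : set (Linf R) :=
  @Sigma R n @` Delta.
Arguments switch_set : clear implicits.

(* Taken on representatives: an element of [Linf R] coerces to one, and the
   value depends only on the classes of [f] and [g] on [0, 1]. *)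
Definition pairing (R : realType) (f g : R -> R) : R :=
  \int[@lebesgue_measure R]_(t in `[0, 1]) (g t * f t).

(* Main.v *)
Require Import Defs.
From mathcomp Require Import all_boot all_order all_algebra.
From mathcomp Require Import all_classical all_reals all_analysis.
From mathcomp Require Import measurable_realfun zify ring lra.

Set Implicit Arguments.
Unset Strict Implicit.
Unset Printing Implicit Defensive.

Import Order.TTheory GRing.Theory Num.Theory.
Import numFieldNormedType.Exports.

Local Open Scope classical_set_scope.
Local Open Scope ring_scope.

(** For [x] in [Delta] let [node_poly x] be the polynomial
    prod_i (x_i ^ 2 - u), of degree [n] in [u]; off the finitely many zeros of
    t |-> (node_poly x).[t ^ 2], the switch function of [x] is the sign of
    (node_poly x).[t ^ 2].  An even polynomial of degree at most 2n - 2 is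
    q.[t ^ 2] with [size q <= n], so everything is expressed through
    polynomials in u = t ^ 2, integrated over [0, 1] in t.

    Uniqueness ([switch_fun_unique]).  If two switch functions S_x and S_y
    satisfy the orthogonality relations, then S_x - S_y is orthogonal to
    q = node_poly x - node_poly y, which has degree less than [n] because the
    leading coefficients cancel.  Where S_x and S_y differ, the two node
    polynomials have opposite signs, so their difference has the sign of S_x,
    which is also the sign of S_x - S_y: the integrand is nonnegative and
    vanishes only where S_x = S_y.  Its integral being zero, S_x = S_y almost
    everywhere.

    Existence ([switch_fun_exists]).  Among the polynomials q of size at most
    n + 1 whose coefficient of degree [n] is (-1) ^ n, minimise the integral
    of |q.[t ^ 2]| - lambda q.[t ^ 2].  Since |lambda| < 1 this functional is
    positive off zero, and it is sublinear and continuous, so that a minimiser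
    exists by compactness ([tilted_norm_minimiser]).  The minimiser is a nonzero
    polynomial, so the functional has the derivative
    r |-> int (sgn q - lambda) r there ([first_variation]), and this derivative
    vanishes at every r of size at most [n].  It remains that the sign of q on
    [0, 1] is a switch function with at most [n] switches ([sign_pattern]):
    q has at most [n] roots, and if it has exactly [n] in (0, 1) then the
    normalisation of its leading coefficient makes it start positive; if it has
    fewer, the spare switches are put at 1, or one of them at 0 to begin with
    the value -1. *)

(** * Sign patterns of polynomials on the unit interval *)

Lemma horner_const_sign (R : realType) (q : {poly R}) :
  (forall u : R, 0 < u < 1 -> ~~ root q u) ->
  (forall u : R, 0 <= u <= 1 -> 0 <= q.[u]) \/
  (forall u : R, 0 <= u <= 1 -> q.[u] <= 0).
Proof.
move=> q_neq0; apply: contrapT => /not_orP[/existsNP[a]].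
move=> /not_implyP[a01 /negP]; rewrite -ltNge => qa.
move=> /existsNP[b] /not_implyP[b01 /negP]; rewrite -ltNge => qb.
have strict (c : R) : q.[c] = 0 ->
    (a <= c <= b) || (b <= c <= a) -> 0 < c < 1.
  move=> c0 cab; have ca : c != a by apply: contraTneq qa => <-; rewrite c0 ltxx.
  have cb : c != b by apply: contraTneq qb => <-; rewrite c0 ltxx.
  by move: ca cb; rewrite !neq_lt;
    case/orP: cab => /andP[? ?] /orP[] ? /orP[] ?; lra.
have [c c0 c01] : exists2 c, q.[c] = 0 & 0 < c < 1.
  have [ab|/ltW ba] := leP a b.
    have [|c cab /eqP c0] := @poly_ivt R q a b ab.
      by rewrite !ltW.
    by exists c => //; apply: strict => //; rewrite cab.
  have [|c cab] := @poly_ivt R (- q) b a ba.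
    by rewrite !hornerN oppr_le0 oppr_ge0 !ltW.
  rewrite rootN => /eqP c0.
  by exists c => //; apply: strict => //; rewrite cab orbT.
by have := q_neq0 _ c01; rewrite /root c0 eqxx.
Qed.

(** For nonzero [q], the list [ys] collects the roots of [q] in (0, 1), with
    multiplicity, and is padded to length [n].  Keeping the multiplicity lets
    the induction divide by one linear factor at a time without deciding where
    [q] really changes sign: a double root gives two equal nodes that cancel.
    The condition on the coefficient of degree [n] passes to the quotients; it
    fixes the sign of the constant left after [n] divisions, where no spare node
    remains to correct that sign. *)
Lemma sign_pattern (R : realType) (n : nat) (q : {poly R}) :
  (size q <= n.+1)%N -> 0 <= (-1) ^+ n * q`_n ->
  exists ys : seq R, [/\ size ys = n, {in ys, forall y, 0 <= y <= 1} &
    forall u : R, 0 <= u <= 1 -> 0 <= q.[u] * (\prod_(y <- ys) (y%:P - 'X)).[u]].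
Proof.
elim: n q => [|n IHn] q sq qn.
  exists [::]; split=> // u _; rewrite big_nil hornerC mulr1.
  by rewrite (size1_polyC sq) hornerC; rewrite expr0 mul1r in qn.
have [[a a01 qa]|noroot] := pselect (exists2 a, 0 < a < 1 & root q a).
  have [r qE] : exists r, q = r * (a%:P - 'X).
    have /factor_theorem[r ->] := qa.
    by exists (- r); rewrite mulNr -mulrN opprB.
  have [qz|qnz] := eqVneq q 0.
    exists (nseq n.+1 0); split=> //; first exact: size_nseq.
      by move=> y /nseqP[-> _]; rewrite lexx ler01.
    by move=> u _; rewrite qz horner0 mul0r.
  have rnz : r != 0 by apply: contraNneq qnz => r0; rewrite qE r0 mul0r.
  have sr : (size r <= n.+1)%N.
    move: sq; rewrite qE -opprB mulrN size_polyN size_Mmonic ?monicXsubC//.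
    by rewrite size_XsubC addn2.
  have rn : r`_n = - q`_n.+1.
    rewrite qE mulrBr coefB coefMC coefMX/= (nth_default 0 sr) mul0r sub0r.
    by rewrite opprK.
  have [||ys [sys ys01 hys]] := IHn r; first exact: sr.
    by rewrite rn mulrN -mulNr -mulN1r -exprS.
  exists (a :: ys); split=> /=; first by rewrite sys.
    move=> y; rewrite inE => /predU1P[->|/ys01//].
    by move: a01; lra.
  move=> u u01; rewrite big_cons qE !hornerM mulrACA mulrCA.
  have := hys u u01; set A := r.[u]; set B := horner _ _; set C := horner _ _.
  by move=> AB; nra.
have ones01 m : {in nseq m (1 : R), forall y, 0 <= y <= 1}.
  by move=> y /nseqP[-> _]; rewrite ler01 lexx.
have onesP m (u : R) : 0 <= u <= 1 -> 0 <= (\prod_(y <- nseq m 1) (y%:P - 'X)).[u].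
  move=> u01; rewrite big_nseq; elim: m => [|m IH] /=; first by rewrite hornerC.
  by rewrite hornerM !hornerE mulr_ge0//; lra.
have [|qge|qle] := @horner_const_sign R q.
- by move=> u u01; apply/negP => qu; apply: noroot; exists u.
(* The constant sign of [q] is absorbed by the spare nodes: the factors 1 - u
   are nonnegative, while the single factor 0 - u reverses the sign. *)
- exists (nseq n.+1 1); split=> //; first exact: size_nseq.
  by move=> u u01; rewrite mulr_ge0 ?qge ?onesP.
- exists (0 :: nseq n 1); split; first by rewrite /= size_nseq.
    by move=> y; rewrite inE => /predU1P[->|/ones01//]; rewrite lexx ler01.
  move=> u u01; rewrite big_cons hornerM mulrA mulr_ge0 ?onesP//.
  by rewrite !hornerE mulr_le0 ?qle//; lra.
Qed.

(** * Switch functions as signs of polynomials *)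

(** The factors are x_i ^ 2 - 'X rather than 'X - x_i ^ 2, so that the value is
    positive to the left of all nodes, where a switch function is 1. *)
Definition node_poly (R : realType) (n : nat) (x : 'rV[R]_n) : {poly R} :=
  \prod_(i < n) ((x ord0 i ^+ 2)%:P - 'X).

Section Switch.
Variables (R : realType) (n : nat).
Implicit Types (x : 'rV[R]_n) (t : R).

Lemma knot_ord x (i : 'I_n) : knot x i.+1 = x ord0 i.
Proof. by rewrite /knot valK. Qed.

Lemma switch_fun_cell x t : Delta x -> 0 <= t < 1 ->
  exists m : nat, [/\ (m <= n)%N, knot x m <= t < knot x m.+1 &
    switch_fun x t = (-1) ^+ m].
Proof.
move=> Dx /andP[t0 t1].
suff [m mn mt] : exists2 m : nat, (m <= n)%N & knot x m <= t < knot x m.+1.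
  by exists m; split=> //; exact: switch_funE.
have : t < knot x n.+1 by rewrite knotS.
elim: {1 3}n.+1 (leqnn n.+1) => [|k IH] kn tk.
  by move: tk; rewrite /= ltNge t0.
have [kt|tk'] := leP (knot x k) t; first by exists k => //; apply/andP.
exact: IH (ltnW kn) tk'.
Qed.

Lemma switch_fun_pm1 x t : Delta x -> 0 <= t < 1 ->
  switch_fun x t = 1 \/ switch_fun x t = -1.
Proof.
move=> Dx t01; have [m [_ _ ->]] := switch_fun_cell Dx t01.
by rewrite -signr_odd; case: odd; [right; rewrite expr1|left; rewrite expr0].
Qed.

(** On the cell where the switch function is (-1) ^ m, exactly the first [m]
    factors of the node polynomial are nonpositive. *)
Lemma switch_fun_node_ge0 x t : Delta x -> 0 <= t < 1 ->
  0 <= switch_fun x t * (node_poly x).[t ^+ 2].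
Proof.
move=> Dx t01; have [m [mn /andP[mt tm] ->]] := switch_fun_cell Dx t01.
have t0 : 0 <= t by case/andP: t01.
have -> : (-1) ^+ m = \prod_(i < n) (if (i < m)%N then -1 else 1) :> R.
  by rewrite -big_mkcond /= (big_ord_narrow mn) prodr_const card_ord.
rewrite /node_poly horner_prod -big_split; apply: prodr_ge0 => i _ /=.
have x0 : 0 <= x ord0 i.
  by rewrite -knot_ord; apply: (knot_mono Dx (leq0n _)); rewrite ltnS ltnW.
rewrite !hornerE; case: ifPn => [im|]; last rewrite -leqNgt => mi.
  have : knot x i.+1 <= knot x m by apply: knot_mono => //; exact: leqW.
  by rewrite knot_ord => xm; rewrite mulN1r opprB subr_ge0 lerXn2r ?nnegrE//; lra.
have : knot x m.+1 <= knot x i.+1 by apply: knot_mono => //; rewrite ltnS ltnW.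
by rewrite knot_ord => xm; rewrite mul1r subr_ge0 lerXn2r ?nnegrE//; lra.
Qed.

Lemma Delta_of_nodes (ys : seq R) : size ys = n ->
  {in ys, forall y, 0 <= y <= 1} ->
  exists2 x : 'rV[R]_n, Delta x & node_poly x = \prod_(y <- ys) (y%:P - 'X).
Proof.
move=> sys ys01; pose s := sort <=%R ys.
have ss : size s = n by rewrite size_sort.
have s01 i : (i < n)%N -> 0 <= s`_i <= 1.
  by move=> ilt; apply: ys01; rewrite -(mem_sort <=%R) mem_nth ?ss.
exists (\row_i Num.sqrt s`_i); last first.
  rewrite -(perm_big _ (permEl (perm_sort <=%R ys))) (big_nth 0) -/s ss.
  rewrite big_mkord; apply: eq_bigr => i _; rewrite mxE sqr_sqrtr//.
  by case/andP: (s01 i (ltn_ord i)).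
have knot_sqrt m (mn : (m < n)%N) :
    knot (\row_(i < n) Num.sqrt s`_i) m.+1 = Num.sqrt s`_m.
  by rewrite (knot_ord _ (Ordinal mn)) mxE.
have le1 m : (m < n)%N -> Num.sqrt s`_m <= 1.
  by move=> mn; rewrite -sqrtr1 ler_sqrt ?ler01//; case/andP: (s01 m mn).
move=> m; rewrite leq_eqVlt => /predU1P[->|mn].
  rewrite knotS; move: knot_sqrt le1; case: (n) => [|n'] hk le1.
    by rewrite /= ler01.
  by rewrite hk ?le1.
case: m mn => [|m] mn; first by rewrite knot_sqrt// sqrtr_ge0.
rewrite !knot_sqrt ?(ltnW mn)// ler_sqrt; last by case/andP: (s01 _ mn).
have sorted_s : sorted <=%R s by apply: sort_sorted => a b; exact: le_total.
by apply: (sorted_ltn_nth le_trans) => //; rewrite inE ss// ltnW.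
Qed.

End Switch.

(** * Integration of bounded measurable functions over the unit interval *)

(** A class of integrable functions which, unlike the integrable functions
    themselves, is closed under products. *)
Definition bounded_meas (R : realType) (f : R -> R) : Prop :=
  measurable_fun (`[0, 1] : set R) f /\
  exists M, forall t, 0 <= t <= 1 -> `|f t| <= M.

Definition int01 (R : realType) (f : R -> R) : R :=
  \int[@lebesgue_measure R]_(t in `[0, 1]) f t.

Section BoundedMeas.
Variable R : realType.
Implicit Types (f g : R -> R) (p : {poly R}).
Local Notation mu := (@lebesgue_measure R).

Lemma lebesgue_measure01 : mu `[0, 1] = 1%E.
Proof. by rewrite lebesgue_measure_itv/= lte01 sube0. Qed.

Lemma bounded_meas_cst c : bounded_meas (fun _ : R => c).
Proof. by split=> //; exists `|c|. Qed.

Lemma bounded_meas_id : bounded_meas (fun t : R => t).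
Proof.
by split; [exact: measurable_id|exists 1 => t /andP[? ?]; rewrite ger0_norm].
Qed.

Lemma bounded_measD f g :
  bounded_meas f -> bounded_meas g -> bounded_meas (fun t => f t + g t).
Proof.
move=> [mf [M fM]] [mg [N gN]]; split; first exact: measurable_funD.
by exists (M + N) => t t01; rewrite (le_trans (ler_normD _ _))// lerD ?fM ?gN.
Qed.

Lemma bounded_measM f g :
  bounded_meas f -> bounded_meas g -> bounded_meas (fun t => f t * g t).
Proof.
move=> [mf [M fM]] [mg [N gN]]; split; first exact: measurable_funM.
by exists (M * N) => t t01; rewrite normrM ler_pM ?fM ?gN.
Qed.

Lemma bounded_measZ c f : bounded_meas f -> bounded_meas (fun t => c * f t).
Proof. by move=> bf; apply: bounded_measM => //; exact: bounded_meas_cst. Qed.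

Lemma bounded_measB f g :
  bounded_meas f -> bounded_meas g -> bounded_meas (fun t => f t - g t).
Proof.
move=> [mf [M fM]] [mg [N gN]]; split; first exact: measurable_funB.
by exists (M + N) => t t01; rewrite (le_trans (ler_normB _ _))// lerD ?fM ?gN.
Qed.

Lemma bounded_meas_norm f : bounded_meas f -> bounded_meas (fun t => `|f t|).
Proof.
move=> [mf [M fM]]; split; first exact: measurableT_comp.
by exists M => t t01; rewrite normr_id fM.
Qed.

Lemma bounded_meas_horner p : bounded_meas (fun t => p.[t]).
Proof.
elim/poly_ind: p => [|p c IH].
  by under eq_fun do rewrite horner0; exact: bounded_meas_cst.
under eq_fun do rewrite hornerD hornerMX hornerC.
by apply: bounded_measD; [apply: bounded_measM => //; exact: bounded_meas_id|
  exact: bounded_meas_cst].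
Qed.

Lemma horner_comp_sq p t : (p \Po 'X^2).[t] = p.[t ^+ 2].
Proof. by rewrite horner_comp hornerXn. Qed.

Lemma bounded_meas_horner_sq p : bounded_meas (fun t => p.[t ^+ 2]).
Proof.
by under eq_fun do rewrite -horner_comp_sq; exact: bounded_meas_horner.
Qed.

Lemma bounded_meas_switch n (x : 'rV[R]_n) : bounded_meas (switch_fun x).
Proof.
split; first by apply: measurable_funTS; exact: measurable_switch_fun.
by exists n.+2%:R => t _; exact: norm_switch_fun_le.
Qed.

Lemma bounded_meas_integrable f :
  bounded_meas f -> mu.-integrable `[0, 1] (EFin \o f).
Proof.
move=> [mf [M fM]]; apply: measurable_bounded_integrable => //.
  by rewrite /= lebesgue_measure01 ltry.
exists M; split; first exact: num_real.
move=> N MN t /=; rewrite in_itv/= => t01.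
by rewrite (le_trans (fM t t01))// ltW.
Qed.

Lemma int01D f g : bounded_meas f -> bounded_meas g ->
  int01 (fun t => f t + g t) = int01 f + int01 g.
Proof. by move=> bf bg; apply: RintegralD => //; exact: bounded_meas_integrable. Qed.

Lemma int01B f g : bounded_meas f -> bounded_meas g ->
  int01 (fun t => f t - g t) = int01 f - int01 g.
Proof. by move=> bf bg; apply: RintegralB => //; exact: bounded_meas_integrable. Qed.

Lemma int01Z c f : bounded_meas f -> int01 (fun t => c * f t) = c * int01 f.
Proof. by move=> bf; apply: RintegralZl => //; exact: bounded_meas_integrable. Qed.

Lemma int01_cst c : int01 (fun _ : R => c) = c.
Proof. by rewrite /int01 Rintegral_cst//= lebesgue_measure01 mulr1. Qed.

Lemma le_int01 f g : bounded_meas f -> bounded_meas g ->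
  (forall t, 0 <= t <= 1 -> f t <= g t) -> int01 f <= int01 g.
Proof.
by move=> bf bg fg; apply: le_Rintegral => //; exact: bounded_meas_integrable.
Qed.

(** The point 1 is left out because the cells of a switch function are closed
    on the left and open on the right; [ae01_closed] reinstates it. *)
Definition ae01 (P : R -> Prop) : Prop :=
  {ae mu, forall t : measurableTypeR R, 0 <= t < 1 -> P t}.

Lemma ae01W (P : R -> Prop) : (forall t, 0 <= t < 1 -> P t) -> ae01 P.
Proof. by move=> P01; apply: aeW. Qed.

Lemma ae01_and (P Q : R -> Prop) : ae01 P -> ae01 Q -> ae01 (fun t => P t /\ Q t).
Proof.
by rewrite /ae01; apply: filterS2 => t Pt Qt t01; split; [exact: Pt|exact: Qt].
Qed.

Lemma ae01_imply (P Q : R -> Prop) :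
  (forall t, 0 <= t < 1 -> P t -> Q t) -> ae01 P -> ae01 Q.
Proof.
by move=> PQ; rewrite /ae01; apply: filterS => t Pt t01; apply: PQ => //; exact: Pt.
Qed.

Lemma ae_neq (a : R) : {ae mu, forall t : measurableTypeR R, t != a}.
Proof.
exists [set a]; split=> //; first by rewrite /= lebesgue_measure_set1.
by move=> t /= /negP; rewrite negbK => /eqP.
Qed.

Lemma ae01_closed (P : R -> Prop) :
  ae01 P <-> {ae mu, forall t : measurableTypeR R, `[0, 1]%classic t -> P t}.
Proof.
rewrite /ae01; split; last first.
  apply: filterS => t Pt /andP[t0 t1]; apply: Pt.
  by rewrite /= in_itv/= t0 ltW.
rewrite /ae01 => P01; have := ae_neq 1; move: P01; apply: filterS2 => t Pt t1.
by rewrite /= in_itv/= => /andP[t0 t1']; apply: Pt; rewrite t0 lt_neqAle t1.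
Qed.

(** Induction on the size: each root accounts for one linear factor, whose zero
    set is a null singleton. *)
Lemma ae01_horner_neq0 p : p != 0 -> ae01 (fun t => p.[t] != 0).
Proof.
move=> p0; suff : {ae mu, forall t : measurableTypeR R, p.[t] != 0}.
  by rewrite /ae01; apply: filterS => t + _.
move: {2}(size p) (leqnn (size p)) p0 => k; elim: k p => [|k IH] p sp p0.
  by move: sp; rewrite leqn0 size_poly_eq0 (negPf p0).
have [[a /factor_theorem[q pE]]|noroot] := pselect (exists a, root p a); last first.
  by apply: aeW => t; apply/negP => pt; apply: noroot; exists t.
have q0 : q != 0 by apply: contraNneq p0 => q0; rewrite pE q0 mul0r.
have sq : (size q <= k)%N.
  by move: sp; rewrite pE size_Mmonic ?monicXsubC// size_XsubC addn2.
have := IH q sq q0; have := ae_neq a; apply: filterS2 => t ta qt.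
by rewrite pE hornerM mulf_neq0// hornerXsubC subr_eq0.
Qed.

Lemma ae01_horner_sq_neq0 p : p != 0 -> ae01 (fun t => p.[t ^+ 2] != 0).
Proof.
move=> p0; have : p \Po 'X^2 != 0 by rewrite comp_poly_eq0 ?size_polyXn.
by move=> /ae01_horner_neq0; apply: ae01_imply => t _; rewrite horner_comp_sq.
Qed.

Lemma eq_int01_ae f g :
  measurable_fun (`[0, 1] : set R) f -> measurable_fun (`[0, 1] : set R) g ->
  ae01 (fun t => f t = g t) -> int01 f = int01 g.
Proof.
move=> mf mg /ae01_closed fg; congr fine; apply: ae_eq_integral => //.
- exact/measurable_EFinP.
- exact/measurable_EFinP.
- by apply: filterS fg => t fg t01; rewrite /= fg.
Qed.

Lemma int01_eq0 f : bounded_meas f -> (forall t, 0 <= t <= 1 -> 0 <= f t) ->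
  int01 f = 0 -> ae01 (fun t => f t = 0).
Proof.
move=> bf f0 if0; apply/ae01_closed.
have int_f := bounded_meas_integrable bf.
have : (\int[mu]_(t in `[0%R, 1%R]%classic) `|(EFin \o f) t| = 0)%E.
  transitivity (\int[mu]_(t in `[0%R, 1%R]%classic) (EFin \o f) t)%E.
    apply: eq_integral => t; rewrite inE /= in_itv/= => t01.
    by rewrite ger0_norm ?f0.
  rewrite -[LHS]fineK; last exact: integrable_fin_num.
  by rewrite -[X in X%:E]/(int01 f) if0.
move/ae_eq_integral_abs => []//.
  by apply/measurable_EFinP; case: bf.
move=> A [mA A0 fA]; exists A; split=> // t ft; apply: fA => /= h; apply: ft => /= t01.
by have := h t01 => -[].
Qed.

End BoundedMeas.

(** * Classes modulo almost everywhere equality, and even polynomials *)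

Section AlmostEverywhere.
Variable R : realType.
Local Notation mu := (@lebesgue_measure R).

Lemma ae_leb01P (P : R -> Prop) :
  {ae leb01 R, forall t : measurableTypeR R, P t} <-> ae01 P.
Proof.
split.
  move=> [A [mA A0 PA]]; exists (A `&` `[0%R, 1%R]%classic); split=> //.
    exact: measurableI.
  move=> t /= /not_implyP[/andP[t0 t1] nPt]; split; first exact: PA.
  by rewrite in_itv/= t0 ltW.
move=> /ae01_closed[A [mA A0 PA]].
exists (A `|` ~` `[0%R, 1%R]%classic); split.
- by apply: measurableU => //; apply: measurableC.
- rewrite /= /mrestr setIUl setICl setU0.
  apply: (subset_measure0 _ mA _ A0); [exact: measurableI|exact: subIsetl].
- move=> t /= nPt; have [t01|] := pselect (`[0%R, 1%R]%classic t); last by right.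
  by left; apply: PA => /= /(_ t01).
Qed.

Lemma ae01_false : ~ ae01 (fun _ : R => False).
Proof.
move=> /ae01_closed[A [mA A0 PA]].
have : (mu `[0%R, 1%R] <= 0)%E.
  rewrite -A0; apply: le_measure; rewrite ?inE// => t /= t01.
  by apply: PA => /= /(_ t01).
by rewrite lebesgue_measure01 lee_fin ler10.
Qed.

Lemma poly_eq0_of_fun (p : {poly R}) : (forall t, p.[t] = 0) -> p = 0.
Proof.
move=> p0; apply/eqP/negPn/negP => /ae01_horner_neq0 pn0; apply: ae01_false.
by apply: ae01_imply pn0 => t _ /eqP; apply.
Qed.

(** The difference p(t) - p(-t) is twice the odd part of [p] at t, so the odd
    part vanishes as a function and hence as a polynomial. *)
Lemma even_poly_comp_sq (p : {poly R}) :
  (forall t : R, p.[- t] = p.[t]) -> p = even_poly p \Po 'X^2.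
Proof.
move=> pE; rewrite -[LHS]poly_even_odd.
suff -> : (odd_poly p \Po 'X^2) * 'X = 0 by rewrite addr0.
apply: poly_eq0_of_fun => t; move: (pE t).
rewrite -[in X in X -> _](poly_even_odd p) !hornerD !hornerMX !horner_comp_sq.
by rewrite sqrrN; lra.
Qed.

End AlmostEverywhere.

(** * The pairing and uniqueness *)

Section Pairing.
Variables (R : realType) (n : nat).
Implicit Types (x y : 'rV[R]_n).

Lemma Sigma_ae x : ae01 (fun t : R => Sigma x t = switch_fun x t).
Proof.
apply/ae_leb01P; have := switch_class_ae x.
by apply: filterS => t /(_ Logic.I).
Qed.

Lemma Sigma_eq x y :
  ae01 (fun t => switch_fun x t = switch_fun y t) -> Sigma x = Sigma y.
Proof.
move=> xy; apply/Linf_eqP.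
have /ae_leb01P : ae01 (fun t : R => Sigma x t = Sigma y t).
  have := ae01_and (Sigma_ae x) (Sigma_ae y); move/(ae01_and xy).
  by apply: ae01_imply => t _ [e [-> ->]].
move=> [A [mA A0 PA]]; exists A; split=> // t /= xy_t; apply: PA => /= e.
by apply: xy_t.
Qed.

Lemma pairing_Sigma x (lambda : R) (p : {poly R}) :
  pairing (fun t => p.[t]) (fun t => Sigma x t - lambda) =
  int01 (fun t => (switch_fun x t - lambda) * p.[t]).
Proof.
have [mp _] := bounded_meas_horner p.
rewrite -[LHS]/(int01 (fun t => (Sigma x t - lambda) * p.[t])).
apply: eq_int01_ae.
- apply: measurable_funM => //; apply: measurable_funB => //.
  apply: measurable_funTS.
  exact: (measurable_funPT (repr (LebesgueSpace.sort (Sigma x)))).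
- apply: measurable_funM => //; apply: measurable_funB => //.
  by apply: measurable_funTS; exact: measurable_switch_fun.
- by apply: ae01_imply (Sigma_ae x) => t _ ->.
Qed.

Lemma node_polyE x :
  node_poly x = (-1) ^+ n *: \prod_(i < n) ('X - (x ord0 i ^+ 2)%:P).
Proof.
rewrite /node_poly; under eq_bigr do rewrite -opprB.
by rewrite prodrN cardT size_enum_ord -mul_polyC rmorphXn rmorphN1.
Qed.

Lemma size_node_poly x : size (node_poly x) = n.+1.
Proof.
rewrite node_polyE size_scale ?signr_eq0// size_prod_XsubC.
by rewrite [index_enum _]unlock -enumT size_enum_ord.
Qed.

Lemma coef_node_poly x : (node_poly x)`_n = (-1) ^+ n.
Proof.
have /monicP := monic_prod_XsubC (index_enum 'I_n) xpredT (fun i => x ord0 i ^+ 2).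
rewrite lead_coefE size_prod_XsubC [X in size X]unlock -enumT size_enum_ord/=.
by rewrite node_polyE coefZ => ->; rewrite mulr1.
Qed.

(** The test polynomial is the difference of the two node polynomials: it has
    degree less than [n], and the sign of S_x - S_y wherever S_x and S_y
    differ.  No combinatorics of the relative order of the nodes is involved. *)
Lemma switch_fun_unique x y (lambda : R) : Delta x -> Delta y ->
  (forall q : {poly R}, (size q <= n)%N ->
    int01 (fun t => (switch_fun x t - lambda) * q.[t ^+ 2]) = 0) ->
  (forall q : {poly R}, (size q <= n)%N ->
    int01 (fun t => (switch_fun y t - lambda) * q.[t ^+ 2]) = 0) ->
  ae01 (fun t => switch_fun x t = switch_fun y t).
Proof.
move=> Dx Dy xorth yorth; pose q := node_poly x - node_poly y.
have sq : (size q <= n)%N.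
  apply/leq_sizeP => j; rewrite leq_eqVlt coefB => /predU1P[<-|nj].
    by rewrite !coef_node_poly subrr.
  by rewrite !nth_default ?size_node_poly ?subrr//.
pose g t := q.[t ^+ 2] * (switch_fun x t - switch_fun y t).
have bS (z : 'rV[R]_n) : bounded_meas (fun t => (switch_fun z t - lambda) * q.[t ^+ 2]).
  apply: bounded_measM; last exact: bounded_meas_horner_sq.
  by apply: bounded_measB; [exact: bounded_meas_switch|exact: bounded_meas_cst].
have bg : bounded_meas g.
  apply: bounded_measM; first exact: bounded_meas_horner_sq.
  by apply: bounded_measB; exact: bounded_meas_switch.
have ig : int01 g = 0.
  rewrite (_ : g = fun t => (switch_fun x t - lambda) * q.[t ^+ 2] -
                            (switch_fun y t - lambda) * q.[t ^+ 2]).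
    by rewrite int01B// xorth ?yorth ?subrr.
  by apply/funext => t; rewrite /g; ring.
have g_ge0 t : 0 <= t < 1 -> 0 <= g t.
  move=> t01; have := switch_fun_node_ge0 Dx t01.
  have := switch_fun_node_ge0 Dy t01; rewrite /g /q hornerD hornerN.
  by case: (switch_fun_pm1 Dx t01) => ->; case: (switch_fun_pm1 Dy t01) => ->; lra.
have ng : int01 (fun t => `|g t|) = 0.
  rewrite -ig; apply: eq_int01_ae.
  - by case: (bounded_meas_norm bg).
  - by case: bg.
  - by apply: ae01W => t t01; rewrite ger0_norm ?g_ge0.
have nz (z : 'rV[R]_n) : ae01 (fun t => (node_poly z).[t ^+ 2] != 0).
  by apply: ae01_horner_sq_neq0; rewrite -size_poly_gt0 size_node_poly.
have := int01_eq0 (bounded_meas_norm bg) (fun _ _ => normr_ge0 _) ng.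
move/(ae01_and (ae01_and (nz x) (nz y))); apply: ae01_imply => t t01.
move=> [[xt yt] /eqP]; rewrite normr_eq0 mulf_eq0 => /orP[|]; last first.
  by rewrite subr_eq0 => /eqP.
(* If the node polynomials agree at t and do not vanish there, then both switch
   functions take their common sign. *)
rewrite /q hornerD hornerN subr_eq0 => /eqP xy.
have := switch_fun_node_ge0 Dx t01; have := switch_fun_node_ge0 Dy t01.
rewrite -xy; case: (switch_fun_pm1 Dx t01) => ->; case: (switch_fun_pm1 Dy t01) => ->//.
- by move=> ? ?; case/negP: xt; rewrite eq_le; apply/andP; split; lra.
- by move=> ? ?; case/negP: xt; rewrite eq_le; apply/andP; split; lra.
Qed.

End Pairing.

(** * Minimising a tilted L1 norm *)

Section MinHomogeneous.
Variables (R : realType) (n : nat).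
Local Notation V := ('rV[R]_n.+1).

(** The minimum of [N] on the unit sphere is positive, hence by homogeneity [N]
    dominates a multiple of the norm; this confines the search for a minimum
    over [C] to a compact ball. *)
Lemma min_homogeneous (N : V -> R) (C : set V) (c0 : V) :
  continuous N -> (forall a v, 0 <= a -> N (a *: v) = a * N v) ->
  (forall v, v != 0 -> 0 < N v) -> closed C -> C c0 ->
  exists2 v, C v & forall w, C w -> N v <= N w.
Proof.
move=> cN hN pN clC Cc0.
have cnorm : continuous (fun v : V => `|v|) by exact: norm_continuous.
have bounded_le (B : R) (A : set V) : (forall v, A v -> `|v| <= B) -> bounded_set A.
  move=> AB; exists B; split; first exact: num_real.
  by move=> M BM v /AB vB; exact: le_trans vB (ltW BM).
have [u u1 u_min] : exists2 u : V, `|u| = 1 & forall v : V, `|v| = 1 -> N u <= N v.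
  pose S := [set v : V | `|v| = 1].
  have [|||u uS u_min] := @EVT_min_rV R n.+1 N S.
  - have e0 : const_mx 1 != 0 :> V.
      by apply/eqP => /rowP/(_ ord0); rewrite !mxE => /eqP; rewrite oner_eq0.
    exists (`|const_mx 1 : V|^-1 *: const_mx 1); rewrite /S /= normrZ normfV normr_id.
    by rewrite mulVf// normr_eq0.
  - apply: bounded_closed_compact; first by apply: (bounded_le 1) => v ->.
    apply: (@closed_comp _ _ (fun v : V => `|v|) [set x | x = 1]).
      by move=> v _; exact: cnorm.
    exact: closed_eq.
  - exact: continuous_subspaceT.
  by exists u; [move: uS; rewrite inE|move=> v v1; apply: u_min; rewrite inE].
have u0 : u != 0 by rewrite -normr_eq0 u1 oner_eq0.
have Nu := pN _ u0.
have N_ge v : N u * `|v| <= N v.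
  have [->|v0] := eqVneq v 0.
    by rewrite normr0 mulr0 -(scale0r (0 : V)) hN// mul0r.
  have nv : 0 < `|v| by rewrite normr_gt0.
  have := u_min (`|v|^-1 *: v); rewrite normrZ normfV normr_id mulVf ?gt_eqF//.
  by rewrite hN ?invr_ge0// mulrC ler_pdivlMr// => /(_ erefl).
pose B := N c0 / N u.
pose K := C `&` [set v | `|v| <= B].
have Kc0 : K c0 by split=> //=; rewrite /B ler_pdivlMr// mulrC.
have [|||v] := @EVT_min_rV R n.+1 N K.
- by exists c0.
- apply: bounded_closed_compact; first by apply: (bounded_le B) => v [].
  apply: closedI => //.
  apply: (@closed_comp _ _ (fun v : V => `|v|) [set x | x <= B]).
    by move=> v _; exact: cnorm.
  exact: closed_le.
- exact: continuous_subspaceT.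
rewrite inE => -[Cv _] v_min; exists v => // w Cw.
have [wB|Bw] := leP `|w| B; first by apply: v_min; rewrite inE.
apply: le_trans (N_ge w); apply: (@le_trans _ _ (N c0)).
  by apply: v_min; rewrite inE.
by move: Bw; rewrite /B ltr_pdivrMr// mulrC => /ltW.
Qed.

End MinHomogeneous.

(** At a nonzero q, its derivative in the direction r is the integral of
    (sgn q - lambda) r, so that its critical points solve the orthogonality
    relations. *)
Definition tilted_norm (R : realType) (lambda : R) (q : {poly R}) : R :=
  int01 (fun t => `|q.[t ^+ 2]| - lambda * q.[t ^+ 2]).

Section TiltedNorm.
Variables (R : realType) (lambda : R).
Hypothesis lambda1 : -1 < lambda < 1.
Implicit Types (p q : {poly R}).

Lemma bounded_meas_tilt (f : R -> R) :
  bounded_meas f -> bounded_meas (fun t => `|f t| - lambda * f t).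
Proof.
by move=> bf; apply: bounded_measB; [exact: bounded_meas_norm|exact: bounded_measZ].
Qed.

Let btilt q := bounded_meas_tilt (bounded_meas_horner_sq q).

Lemma tilted_normD p q :
  tilted_norm lambda (p + q) <= tilted_norm lambda p + tilted_norm lambda q.
Proof.
rewrite -int01D//; apply: le_int01 => // [|t _]; first exact: bounded_measD.
have := ler_normD p.[t ^+ 2] q.[t ^+ 2]; rewrite hornerD mulrDr; lra.
Qed.

Lemma tilted_normZ a q : 0 <= a ->
  tilted_norm lambda (a *: q) = a * tilted_norm lambda q.
Proof.
move=> a0; rewrite -int01Z//; congr int01; apply/funext => t.
by rewrite hornerZ normrM (ger0_norm a0); ring.
Qed.

Lemma tilted_norm_le q (M : R) : (forall u, 0 <= u <= 1 -> `|q.[u]| <= M) ->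
  tilted_norm lambda q <= 2 * M.
Proof.
move=> qM; rewrite -(int01_cst (2 * M)); apply: le_int01 => //.
  exact: bounded_meas_cst.
move=> t t01; have {}qM : `|q.[t ^+ 2]| <= M.
  by apply: qM; rewrite sqr_ge0/= expr_le1//; case/andP: t01.
have : `|lambda * q.[t ^+ 2]| <= M.
  rewrite normrM (le_trans _ qM)// ler_piMl// ler_norml.
  by case/andP: lambda1 => ? ?; rewrite !ltW.
by rewrite ler_norml => /andP[? ?]; lra.
Qed.

(** Here |lambda| < 1 is essential: it makes |a| - lambda a positive for every
    a != 0. *)
Lemma tilted_norm_gt0 q : q != 0 -> 0 < tilted_norm lambda q.
Proof.
move=> q0; have nonneg t : 0 <= `|q.[t ^+ 2]| - lambda * q.[t ^+ 2].
  by case: (ger0P q.[t ^+ 2]) => ?; case/andP: lambda1 => ? ?; nra.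
have N0 : 0 <= tilted_norm lambda q by apply: Rintegral_ge0.
rewrite lt_neqAle N0 andbT; apply/eqP => /esym Nz; apply: (@ae01_false R).
have := ae01_and (ae01_horner_sq_neq0 q0)
  (int01_eq0 (btilt q) (fun t _ => nonneg t) Nz).
apply: ae01_imply => t _ [/eqP qt]; case: (ger0P q.[t ^+ 2]) => ? ?; apply: qt;
  case/andP: lambda1 => ? ?; nra.
Qed.

Lemma norm_horner_rVpoly_le n (v : 'rV[R]_n) (u : R) : 0 <= u <= 1 ->
  `|(rVpoly v).[u]| <= n%:R * `|v|.
Proof.
move=> /andP[u0 u1].
rewrite (@horner_coef_wide _ n) ?size_poly// (le_trans (ler_norm_sum _ _ _))//.
apply: (@le_trans _ _ (\sum_(i < n) `|v|)); last by rewrite sumr_const card_ord mulr_natl.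
apply: ler_sum => i _; rewrite coef_rVpoly_ord normrM (ger0_norm (exprn_ge0 _ u0)).
apply: (@le_trans _ _ `|v 0 i|); first by rewrite ler_piMr// exprn_ile1.
rewrite -[leRHS]/(mx_norm v) mx_normrE.
by apply/bigmax_geP; right; exists (ord0, i).
Qed.

(** By subadditivity, the increments of the tilted norm are bounded by its
    values on the difference, which are at most a multiple of the norm. *)
Lemma continuous_tilted_norm n :
  continuous (fun v : 'rV[R]_n => tilted_norm lambda (rVpoly v)).
Proof.
pose L : R := 2 * n%:R; have L0 : 0 <= L by rewrite mulr_ge0.
have lip (v w : 'rV[R]_n) :
    tilted_norm lambda (rVpoly v) - tilted_norm lambda (rVpoly w) <= L * `|v - w|.
  rewrite lerBlDr -{1}(subrK w v) linearD (le_trans (tilted_normD _ _))// lerD2r.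
  by rewrite /L -mulrA; apply: tilted_norm_le => u; exact: norm_horner_rVpoly_le.
move=> v; apply: (proj2 (@cvgrPdist_lt _ _ _ (nbhs v) _ _ _)) => e e0.
apply/(@nbhs_normP _ 'rV[R]_n).
exists (e / (L + 1)); first by rewrite /= divr_gt0// ltr_wpDl.
move=> w /= vw; have Le : L * `|v - w| < e.
  move: vw; rewrite ltr_pdivlMr ?ltr_wpDl//; have := normr_ge0 (v - w); nra.
by rewrite ltr_norml; have := lip v w; have := lip w v; rewrite (distrC w v); lra.
Qed.

Lemma tilted_norm_minimiser n (c : R) :
  exists q, [/\ (size q <= n.+1)%N, q`_n = c & forall p, (size p <= n.+1)%N ->
    p`_n = c -> tilted_norm lambda q <= tilted_norm lambda p].
Proof.
pose C := [set v : 'rV[R]_n.+1 | v ord0 ord_max = c].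
have [|||||v vc v_min] := @min_homogeneous R n
    (fun v => tilted_norm lambda (rVpoly v)) C (const_mx c).
- exact: continuous_tilted_norm.
- by move=> a v a0; rewrite linearZ tilted_normZ.
- move=> v v0; apply: tilted_norm_gt0; apply: contra v0 => /eqP rv0.
  by rewrite -(rVpolyK v) rv0 linear0.
- apply: (@closed_comp _ _ (fun v : 'rV[R]_n.+1 => v ord0 ord_max) [set x | x = c]).
    by move=> v _; exact: coord_continuous.
  exact: closed_eq.
- by rewrite /C /= mxE.
exists (rVpoly v); split; first exact: size_poly.
  by rewrite -vc -coef_rVpoly_ord.
move=> p sp pc; have := v_min (poly_rV p); rewrite poly_rV_K//; apply.
by rewrite /C /= mxE.
Qed.

End TiltedNorm.

(** * First variation and existence *)

Section FirstVariation.
Variables (R : realType) (lambda : R).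
Local Notation mu := (@lebesgue_measure R).

Lemma norm_perturb (a b s : R) : a != 0 -> s * a = `|a| -> `|b| <= `|a| ->
  `|a + b| = s * (a + b).
Proof.
move=> a0 sa ba; have s2 : s = Num.sg a.
  by apply: (mulIf a0); rewrite sa normrEsg.
rewrite s2; case: (sgrP a) a0 ba => [->|a_gt0|a_lt0]; first by [].
- by rewrite ler_norml mul1r => _ /andP[? ?]; rewrite ger0_norm//; lra.
- by rewrite ler_norml mulN1r => _ /andP[? ?]; rewrite ler0_norm//; lra.
Qed.

(** The difference quotients along f + g / (k + 1) have nonnegative integrals and
    are bounded by |g| + |lambda g|; at a point where f does not vanish they are
    eventually equal to (s - lambda) g, since a small perturbation does not
    change the sign of f.  Dominated convergence transfers the sign of the
    integrals to the derivative. *)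
Lemma first_variation (f g s : R -> R) :
  bounded_meas f -> bounded_meas g -> bounded_meas s ->
  ae01 (fun t => f t != 0) -> ae01 (fun t => s t * f t = `|f t|) ->
  (forall k : nat, int01 (fun t => `|f t| - lambda * f t) <=
    int01 (fun t => `|f t + k.+1%:R^-1 * g t| - lambda * (f t + k.+1%:R^-1 * g t))) ->
  0 <= int01 (fun t => (s t - lambda) * g t).
Proof.
move=> bf bg bs f0 sf fmin.
pose h (k : nat) t := k.+1%:R * ((`|f t + k.+1%:R^-1 * g t| -
  lambda * (f t + k.+1%:R^-1 * g t)) - (`|f t| - lambda * f t)).
pose h' t := (s t - lambda) * g t.
have bfg k : bounded_meas (fun t => f t + k.+1%:R^-1 * g t).
  by apply: bounded_measD => //; exact: bounded_measZ.
have bh k : bounded_meas (h k).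
  apply: bounded_measZ; apply: bounded_measB; exact: bounded_meas_tilt.
have bh' : bounded_meas h'.
  by apply: bounded_measM => //; apply: bounded_measB => //; exact: bounded_meas_cst.
have ih k : 0 <= int01 (h k).
  rewrite /h int01Z; last by apply: bounded_measB; exact: bounded_meas_tilt.
  rewrite int01B; try exact: bounded_meas_tilt.
  by apply: mulr_ge0 => //; rewrite subr_ge0; exact: fmin.
have bG : bounded_meas (fun t => `|g t| + `|lambda * g t|).
  apply: bounded_measD; apply: bounded_meas_norm => //; exact: bounded_measZ.
have [|||||_ _] := @dominated_convergence _ _ R mu `[0%R, 1%R]%classic
    (measurable_itv _)
    (fun k => EFin \o h k) (EFin \o h')
    (EFin \o (fun t => `|g t| + `|lambda * g t|)).
- by move=> k; apply/measurable_EFinP; case: (bh k).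
- by apply/measurable_EFinP; case: bh'.
- have /ae01_closed := ae01_and f0 sf.
  apply: filterS => t fsf t01; have {fsf t01} [ft st] := fsf t01.
  apply: cvg_near_cst; near=> k; congr EFin.
  have kn : 0 < k.+1%:R :> R by [].
  have small : `|k.+1%:R^-1 * g t| <= `|f t|.
    rewrite normrM normfV (gtr0_norm kn) ler_pdivrMl// -ler_pdivrMr ?normr_gt0//.
    apply: (@le_trans _ _ k%:R); last by rewrite ler_nat.
    by near: k; exact: nbhs_infty_ger.
  rewrite /h (norm_perturb ft st small) -st /h'; field.
  by rewrite gt_eqF.
- exact: bounded_meas_integrable.
- apply: aeW => t k _ /=; rewrite lee_fin.
  have kn : 0 < k.+1%:R :> R by [].
  have -> : h k t = k.+1%:R * (`|f t + k.+1%:R^-1 * g t| - `|f t|) - lambda * g t.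
    by rewrite /h; field; rewrite gt_eqF.
  rewrite (le_trans (ler_normB _ _))// lerD2r normrM (gtr0_norm kn).
  rewrite -ler_pdivlMl// (le_trans (ler_dist_dist _ _))//.
  by rewrite addrC addKr normrM normfV (gtr0_norm kn).
move=> lim_h; apply: fine_ge0; apply: cvge_ge lim_h.
apply: nearW => k; rewrite /= -[leRHS]fineK; first by rewrite lee_fin; exact: ih.
by apply: integrable_fin_num => //; exact: bounded_meas_integrable.
Unshelve. all: by end_near. Qed.

End FirstVariation.

Section Existence.
Variables (R : realType) (lambda : R) (n : nat).
Hypothesis lambda1 : -1 < lambda < 1.

Lemma switch_fun_exists : exists2 x : 'rV[R]_n, Delta x &
  forall r : {poly R}, (size r <= n)%N ->
    int01 (fun t => (switch_fun x t - lambda) * r.[t ^+ 2]) = 0.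
Proof.
have [q [sq qn q_min]] := tilted_norm_minimiser lambda1 n ((-1) ^+ n).
have q0 : q != 0.
  by apply/eqP => q0; move/eqP: qn; rewrite q0 coef0 eq_sym signr_eq0.
have [|ys [sys ys01 ys_sign]] := sign_pattern sq.
  by rewrite qn -expr2 sqr_ge0.
have [x Dx xE] := Delta_of_nodes sys ys01; exists x => //.
have Sq : ae01 (fun t => switch_fun x t * q.[t ^+ 2] = `|q.[t ^+ 2]|).
  have nx0 : ae01 (fun t => (node_poly x).[t ^+ 2] != 0).
    by apply: ae01_horner_sq_neq0; rewrite -size_poly_gt0 size_node_poly.
  apply: ae01_imply nx0 => t t01 nxt; have Sx := switch_fun_node_ge0 Dx t01.
  have : 0 <= q.[t ^+ 2] * (node_poly x).[t ^+ 2].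
    rewrite xE; apply: ys_sign; case/andP: t01 => t0 t1.
    by rewrite sqr_ge0 expr_le1// ltW.
  move: Sx nxt; rewrite neq_lt.
  by case: (switch_fun_pm1 Dx t01) => -> Sx /orP[] nxt qnx;
    [rewrite ger0_norm|rewrite ger0_norm|rewrite ler0_norm|rewrite ler0_norm]; nra.
(* Since r has degree less than [n], adding a multiple of it to [q] preserves the
   constraint on the coefficient of degree [n]. *)
have variation (r : {poly R}) : (size r <= n)%N ->
    0 <= int01 (fun t => (switch_fun x t - lambda) * r.[t ^+ 2]).
  move=> sr; apply: (first_variation (f := fun t => q.[t ^+ 2])) => //.
  - exact: bounded_meas_horner_sq.
  - exact: bounded_meas_horner_sq.
  - exact: bounded_meas_switch.
  - exact: ae01_horner_sq_neq0.
  move=> k; have := q_min (q + k.+1%:R^-1 *: r).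
  rewrite /tilted_norm.
  under [X in _ -> _ -> _ <= int01 X]eq_fun do rewrite hornerD hornerZ.
  apply.
    rewrite (leq_trans (size_polyD _ _))// geq_max sq.
    by rewrite (leq_trans (size_scale_leq _ _))// ltnW.
  by rewrite coefD coefZ qn (nth_default 0 sr) mulr0 addr0.
move=> r sr; apply/eqP; rewrite eq_le variation// andbT -oppr_ge0.
have := variation (- r); rewrite size_polyN => /(_ sr).
under eq_fun do rewrite hornerN mulrN -mulN1r.
rewrite int01Z ?mulN1r//; apply: bounded_measM; last exact: bounded_meas_horner_sq.
by apply: bounded_measB; [exact: bounded_meas_switch|exact: bounded_meas_cst].
Qed.

End Existence.

Unset Implicit Arguments.

Theorem theorem5p2 (R : realType) (n : nat) (lambda : R) :
  (1 <= n)%N -> -1 < lambda < 1 ->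
  exists! sigma : Linf R,
    switch_set R n sigma /\
    forall p : {poly R},
      (forall t : R, p.[- t] = p.[t]) -> (size p <= (2 * n - 2).+1)%N ->
      pairing (fun t => p.[t]) (fun t => sigma t - lambda) = 0.
Proof.
move=> n1 lambda1.
have [x Dx xorth] := switch_fun_exists n lambda1.
exists (Sigma x); split.
  split; first by exists x.
  move=> p p_even sp; rewrite pairing_Sigma (even_poly_comp_sq p_even).
  under eq_fun do rewrite horner_comp_sq.
  apply: xorth; rewrite (leq_trans (size_even_poly p))// leq_uphalf_double.
  by move: sp n1; lia.
move=> _ [[y Dy <-] yorth]; apply: Sigma_eq; apply: switch_fun_unique xorth _ => //.
move=> q sq; under eq_fun do rewrite -horner_comp_sq.
rewrite -pairing_Sigma; apply: yorth => [t|].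
  by rewrite !horner_comp_sq sqrrN.
have [->|q0] := eqVneq q 0; first by rewrite comp_poly0 size_poly0.
have := size_comp_poly q 'X^2; rewrite size_polyXn /= => sc.
have: size (q \Po 'X^2) != 0%N by rewrite size_poly_eq0 comp_poly_eq0 ?size_polyXn.
rewrite -size_poly_gt0 in q0; move: sc sq q0 n1.
by move: (size _) (size q) => a b; lia.
Qed.
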